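(* Let $\theta=(k_r)$ be a lacunary sequence with $\liminf_r q_r>1$. If $(f_n)$ is a sequence of $N_\theta$-ward continuous functions on a subset $A$ of $\mathbb{R}$ and $(f_n)$ converges uniformly on $A$ to a function $f:A\to\mathbb{R}$, then $f$ is $N_\theta$-ward continuous on $A$.
   Context: A lacunary sequence is an increasing sequence of integers $\theta=(k_r)_{r\ge 0}$ with $k_0=0$ and $h_r:=k_r-k_{r-1}\to\infty$. Put $I_r=(k_{r-1},k_r]$ (integers in this interval) and $q_r=k_r/k_{r-1}$ (for $r\ge 2$). A real sequence $(\alpha_k)_{k\ge1}$ is $N_\theta$-quasi-Cauchy if $\lim_{r\to\infty}\frac1{h_r}\sum_{k\in I_r}|\alpha_{k+1}-\alpha_k|=0$. A function $f:A\to\mathbb{R}$ is $N_\theta$-ward continuous on $A$ if $(f(\alpha_k))$ is $N_\theta$-quasi-Cauchy whenever $(\alpha_k)$ is an $N_\theta$-quasi-Cauchy sequence of points in $A$. *)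

(* Defs.v *)
From mathcomp Require Import all_boot all_order all_algebra.
From mathcomp Require Import all_classical all_reals all_analysis.

Set Implicit Arguments.
Unset Strict Implicit.
Unset Printing Implicit Defensive.

Import Order.TTheory GRing.Theory Num.Theory.
Import numFieldNormedType.Exports.

Local Open Scope classical_set_scope.
Local Open Scope ring_scope.

(* A lacunary sequence of integers starts at 0 and increases, so it is encoded
   as a function into nat. h_r is meaningful for r >= 1; since 0.-1 = 0, the
   junk value at r = 0 is 0. *)
Definition lac_gap (theta : nat -> nat) (r : nat) : nat :=
  (theta r - theta r.-1)%N.

Definition lacunary (theta : nat -> nat) : Prop :=
  [/\ {homo theta : m n / (m < n)%N},
      theta 0%N = 0%N
    & lac_gap theta r @[r --> \oo] --> \oo].

(* q_r is meaningful for r >= 2; the junk values at r = 0, 1 (division by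
   theta 0 = 0) do not affect the lower limit. *)
Definition lac_ratio (R : realType) (theta : nat -> nat) (r : nat) : R :=
  (theta r)%:R / (theta r.-1)%:R.

(* Real sequences are indexed from 1: for r >= 1 the index i ranges over the
   integers of (k_(r-1), k_r], so alpha 0 is never used. *)
Definition Ntheta_mean (R : realType) (theta : nat -> nat) (alpha : nat -> R)
    (r : nat) : R :=
  (lac_gap theta r)%:R^-1 *
  \sum_((theta r.-1).+1 <= i < (theta r).+1) `|alpha i.+1 - alpha i|.

Definition Ntheta_quasi_Cauchy (R : realType) (theta : nat -> nat)
    (alpha : nat -> R) : Prop :=
  Ntheta_mean theta alpha r @[r --> \oo] --> (0 : R).

(* A function on A is a total function of which only the values on A matter. *)
Definition Ntheta_ward_continuous (R : realType) (theta : nat -> nat)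
    (A : set R) (f : R -> R) : Prop :=
  forall alpha : nat -> R,
    (forall i, (0 < i)%N -> A (alpha i)) ->
    Ntheta_quasi_Cauchy theta alpha ->
    Ntheta_quasi_Cauchy theta (f \o alpha).

(* Main.v *)
(** Replacing f by a uniformly e-close f_N changes each average over I_r by at
    most 2e, uniformly in r, so an e/3 argument applies. *)
Require Import Defs.
From mathcomp Require Import all_boot all_order all_algebra.
From mathcomp Require Import all_classical all_reals all_analysis.
From mathcomp Require Import ring.

Import Order.TTheory GRing.Theory Num.Theory.
Import numFieldNormedType.Exports.

Local Open Scope classical_set_scope.
Local Open Scope ring_scope.

(** The block averages are stable under uniform perturbation: an increment has two endpoints, so an
    error [e] at each term costs at most [2e], and averaging keeps this bound whatever [r] is
    ([Ntheta_mean_close]). Hence one fixed [f_ N] within [e / 3] of [f] on [A] suffices: its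
    averages are eventually at most [e / 3], and those of [f] exceed them by at most [2e / 3]. *)

Lemma Ntheta_mean_ge0 (R : realType) (theta : nat -> nat) (a : nat -> R)
    (r : nat) : 0 <= Ntheta_mean theta a r.
Proof. by rewrite mulr_ge0 ?invr_ge0 ?ler0n// sumr_ge0. Qed.

Lemma Ntheta_mean_close (R : realType) (theta : nat -> nat) (a b : nat -> R)
    (e : R) (r : nat) : 0 <= e ->
  (forall i, (0 < i)%N -> `|a i - b i| <= e) ->
  Ntheta_mean theta b r <= Ntheta_mean theta a r + e *+ 2.
Proof.
move=> e0 ab; rewrite /Ntheta_mean.
set h : R := (lac_gap theta r)%:R.
(* Only an inequality: at [r = 0] the gap [h] is 0 and [h^-1] is 0 by convention. *)
have he : h^-1 * (h * (e *+ 2)) <= e *+ 2.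
  have [->|h0] := eqVneq h 0; first by rewrite mul0r mulr0 mulrn_wge0.
  by rewrite mulKf.
apply: (le_trans _ (lerD (lexx _) he)); rewrite -mulrDr.
apply: ler_wpM2l; first by rewrite invr_ge0 ler0n.
(* The block has exactly [h] indices, so the error is spread as [2e] per increment. *)
have -> : h * (e *+ 2) =
    \sum_((theta r.-1).+1 <= i < (theta r).+1) (e *+ 2).
  by rewrite big_const_nat subSS iter_addr_0 mulr_natl.
rewrite -big_split/= big_nat_cond [leRHS]big_nat_cond.
apply: ler_sum => i /andP[/andP[ri _] _].
have i0 : (0 < i)%N by exact: leq_ltn_trans ri.
have -> : b i.+1 - b i = a i.+1 - a i + (a i - b i - (a i.+1 - b i.+1)).
  by ring.
rewrite (le_trans (ler_normD _ _))// lerD2l (le_trans (ler_normB _ _))//.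
by rewrite mulr2n lerD ?ab.
Qed.

Theorem theorem21 (R : realType) (theta : nat -> nat)
  (theta_lac : lacunary theta)
  (liminf_q : (1 < limn_einf (fun r => (lac_ratio R theta r)%:E))%E)
  (A : set R) (f_ : nat -> R -> R) (f : R -> R)
  (f_ward : forall n, Ntheta_ward_continuous theta A (f_ n))
  (f_cvg : {uniform A, f_ @ \oo --> f}) :
  Ntheta_ward_continuous theta A f.
Proof.
move=> alpha alphaA alphaC; apply/cvgrPdist_le => e e0.
have e3 : 0 < e / 3 by rewrite divr_gt0.
have [N fN] : exists N, forall x, A x -> `|f_ N x - f x| <= e / 3.
  (* Uniform convergence is read through the entourage of pairs at distance less than [e / 3]. *)
  have : nbhs (f : {uniform` A -> R})
      [set g | forall x, A x -> `|g x - f x| <= e / 3].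
    apply/uniform_nbhs; exists [set xy | `|xy.1 - xy.2| < e / 3].
    split; first exact: (entourage_ball R (PosNum e3)).
    by move=> g /= fg x Ax; rewrite distrC ltW ?fg.
  by move=> /f_cvg[N _ fN]; exists N; exact: (fN N (leqnn N)).
have /cvgrPdist_le/(_ _ e3) := f_ward N _ alphaA alphaC.
apply: filterS => r; rewrite !sub0r !normrN !ger0_norm ?Ntheta_mean_ge0// => Hr.
have close i : (0 < i)%N -> `|(f_ N \o alpha) i - (f \o alpha) i| <= e / 3.
  by move=> i0; exact/fN/alphaA.
apply: (le_trans (Ntheta_mean_close _ _ _ _ _ r (ltW e3) close)).
by rewrite (le_trans (lerD Hr (lexx _)))// -mulrS -[_ *+ 3]mulr_natr divfK.
Qed.
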